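(* For any noise level $\eta\ge1$, any positive integers $d$, $m$, $(d_u,T_u)_{u=1}^m$ and integer $B$ satisfying $d_u\le T_u$ for all $u\in[m]$, $\sum_{u=1}^m d_u\le d$, and $B\ge\sum_{u=1}^m d_u$, with $T=\sum_u T_u$, there exists an oblivious adversary such that: 1. it uses a ground truth $\theta^*\in\mathbb{R}^d$ with $\|\theta^*\|_2\le\sqrt d$ and $|\langle\theta^*,x_t\rangle|\le1$ for all $t$, and the noises $\xi_t=y_t-\langle\theta^*,x_t\rangle$ are independent zero-mean sub-Gaussian with variance proxy $\eta^2$; 2. it shows a sequence $x_1,\dots,x_T$ with $\|x_t\|_2\le1$ such that $[T]$ can be partitioned into disjoint nonempty sets $I_1,\dots,I_m$ with $|I_u|=T_u$ and $\{x_t:t\in I_u\}$ lying in a subspace of dimension $d_u$; 3. every online active learning algorithm whose expected number of label queries is at most $B$ has expected regret $\mathbb{E}[R]\ge c\,\big(\sum_{u=1}^m\sqrt{d_uT_u}\big)^2/B$, where $c>0$ is an absolute constant.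
   Context: Online active regression protocol: an oblivious adversary fixes $\theta^*\in\mathbb{R}^d$ and inputs $x_1,\dots,x_T$ in advance; labels are $y_t=\langle\theta^*,x_t\rangle+\xi_t$ with independent zero-mean noise. At each round the learner sees $x_t$, predicts $\hat y_t$ (using only previously observed information), and then decides whether to query ($q_t\in\{0,1\}$); if $q_t=1$ it observes $y_t$. Regret: $R=\sum_{t=1}^T(\hat y_t-\langle\theta^*,x_t\rangle)^2$; number of queries $Q=\sum_t q_t$.
   Formalization: The adversary draws θ* at random in advance, independently of the noise and the learner (for a fixed θ* a learner could predict ⟨θ*,x_t⟩ with no queries and zero regret); expectations also average over θ*, and learners are assumed measurable. *)

(* Defs.v *)
From HB Require Import structures.
From mathcomp Require Import all_boot all_order all_algebra.
From mathcomp Require Import all_classical all_reals all_analysis.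
Set Implicit Arguments. Unset Strict Implicit. Unset Printing Implicit Defensive.
Import Order.TTheory GRing.Theory Num.Theory.
Local Open Scope classical_set_scope.
Local Open Scope ring_scope.

Section Defs.
Variable R : realType.

Definition inner (d : nat) (u v : 'rV[R]_d) : R := \sum_(i < d) u ord0 i * v ord0 i.
Definition norm2 (d : nat) (u : 'rV[R]_d) : R := Num.sqrt (inner u u).

Definition zero_mean_subgaussian {dE : measure_display} {E : measurableType dE}
    (P : probability E R) (X : E -> R) (s2 : R) :=
  measurable_fun setT X /\
  P.-integrable setT (EFin \o X) /\
  (\int[P]_e (X e)%:E = 0)%E /\
  forall lam : R, (\int[P]_e (expR (lam * X e))%:E <= (expR (lam ^+ 2 * s2 / 2))%:E)%E.

(* Mutual independence of the random elements theta (R^d-valued), xi_0, ..., xi_{T-1}: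
   product rule on the generating pi-system of measurable rectangles
   (taking some factors equal to setT gives the product rule for every subfamily). *)
Definition indep_theta_noise {dE : measure_display} {E : measurableType dE}
    (P : probability E R) (d T : nat) (theta : E -> 'rV[R]_d) (xi : nat -> E -> R) :=
  forall (C : 'I_d -> set R) (A : 'I_T -> set R),
    (forall i, measurable (C i)) -> (forall t, measurable (A t)) ->
    fine (P ([set e | forall i, C i (theta e ord0 i)] `&`
             [set e | forall t : 'I_T, A t (xi t e)])) =
    fine (P [set e | forall i, C i (theta e ord0 i)]) *
    \prod_(t < T) fine (P [set e | A t (xi t e)]).

(* An online active learner whose internal randomness is a seed a : A.
   At round t (0-based) it sees only the seed and the observation history of the
   previous rounds (Some y_s if round s was queried, None otherwise); the inputs
   x_s are fixed in advance by the oblivious adversary, so they are known to the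
   learner as a function of s. It outputs a prediction and a query decision. *)
Record learner (A : Type) := Learner {
  lpred  : nat -> A -> seq (option R) -> R;
  lquery : nat -> A -> seq (option R) -> bool }.

Fixpoint hist A (L : learner A) (a : A) (y : nat -> R) (t : nat) : seq (option R) :=
  match t with
  | 0 => [::]
  | t'.+1 => let h := hist L a y t' in
             rcons h (if lquery L t' a h then Some (y t') else None)
  end.

Definition prediction A (L : learner A) a y t : R := lpred L t a (hist L a y t).
Definition queried A (L : learner A) a y t : bool := lquery L t a (hist L a y t).

Definition labels d (theta : 'rV[R]_d) (x : nat -> 'rV[R]_d) (xi : nat -> R) : nat -> R :=
  fun t => inner theta (x t) + xi t.

Definition regret A (L : learner A) a d (theta : 'rV[R]_d) x xi (T : nat) : R :=
  \sum_(t < T) (prediction L a (labels theta x xi) t - inner theta (x t)) ^+ 2.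

Definition num_queries A (L : learner A) a d (theta : 'rV[R]_d) x xi (T : nat) : nat :=
  (\sum_(t < T) queried L a (labels theta x xi) t)%N.
End Defs.

(* Main.v *)
Require Import Defs.
From HB Require Import structures.
From mathcomp Require Import all_boot all_order all_algebra.
From mathcomp Require Import all_classical all_reals all_analysis.
From mathcomp Require Import measurable_realfun ring lra zify.
Set Implicit Arguments. Unset Strict Implicit. Unset Printing Implicit Defensive.
Import Order.TTheory GRing.Theory Num.Theory.
Local Open Scope classical_set_scope.
Local Open Scope ring_scope.

(** The ground truth has independent uniform signs, [theta_i = +- delta_i], and every
    input is a basis vector, the rounds of group [u] being spread evenly over [d_u]
    coordinates. The noise in coordinate [i] lives on the lattice of step [2 delta_i],
    so flipping the sign of [theta_i] shifts the label by one lattice step; with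
    squared triangular weights of width about [1 / delta_i] the two label laws have
    Hellinger affinity [1 - O(delta_i^2)].

    Propagating affinities backwards along the learner's histories gives, at each
    round of coordinate [i], an expected squared error of at least
    [delta_i^2 - 64 delta_i^4 Q_i], where [Q_i] is the expected number of queries in
    coordinate [i]. This is linear in the query counts, so it survives averaging over
    the learner's seed, and [delta_i^2] proportional to
    [min (1, S / (B sqrt (T_u / d_u)))] with [S = \sum_u sqrt (d_u T_u)] balances the
    groups. *)

(** * Sub-Gaussian bound and finite probability spaces *)

(** For a centered variable the linear term averages out, leaving a sub-Gaussian bound. If [x > 1/2]
    then [x <= 2 * x ^+ 2]; otherwise [(1 - x) * expR x <= 1], while [(1 - x) * (1 + x + 2 * x ^+ 2)
    = 1 + x ^+ 2 * (1 - 2 * x) >= 1]. *)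
Lemma expR_le_linear_sqr (R : realType) (x : R) : expR x <= x + expR (2 * x ^+ 2).
Proof.
have E2 := expR_ge1Dx (2 * x ^+ 2).
have [xle|xgt] := leP x (1/2); last first.
  have : expR x <= expR (2 * x ^+ 2) by rewrite ler_expR; nra.
  by lra.
have Em := expR_ge1Dx (- x).
rewrite expRN in Em.
have E0 := expR_gt0 x.
have : (1 - x) * expR x <= 1.
  by rewrite -ler_pdivlMr // mul1r.
move: E0 E2; set y := expR x; set z := expR _ => E0 E2 H.
have : y <= 1 + x + 2 * x ^+ 2 by nra.
lra.
Qed.

Definition fin_space (X : finType) (x0 : X) : Type := X.

Section FinSpace.
Variables (X : finType) (x0 : X).

HB.instance Definition _ := Choice.on (fin_space x0).
HB.instance Definition _ := isPointed.Build (fin_space x0) x0.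
HB.instance Definition _ := @isMeasurable.Build default_measure_display
  (fin_space x0) (@discrete_measurable (fin_space x0)) discrete_measurable0
  discrete_measurableC discrete_measurableU.

Lemma fin_space_measurable_fun {d} (Y : measurableType d) (f : fin_space x0 -> Y) :
  measurable_fun setT f.
Proof. by []. Qed.

End FinSpace.

Section FinProb.
Variables (R : realType) (X : finType) (x0 : X) (w : X -> R).
Hypotheses (w_ge0 : forall x, 0 <= w x) (w_sum : \sum_x w x = 1).

Let atom (i : nat) : {measure set (fin_space x0) -> \bar R} :=
  mscale (NngNum (w_ge0 (nth x0 (enum X) i))) (\d_(nth x0 (enum X) i : fin_space x0)).

(** Carrying the normalization proof in the term lets the probability instance be inferred from
    it. *)
Definition fin_prob (_ : \sum_x w x = 1) :
  set (fin_space x0) -> \bar R := msum atom #|X|.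

Local Notation P := (fin_prob w_sum).

HB.instance Definition _ := Measure.on P.

Let sum_enum (F : X -> R) :
  \sum_(i < #|X|) F (nth x0 (enum X) i) = \sum_x F x.
Proof.
rewrite [RHS](reindex _ (onW_bij _ (@enum_val_bij X))).
by apply: eq_bigr => i _; rewrite (enum_val_nth x0).
Qed.

Lemma fin_probE (S : set (fin_space x0)) :
  P S = (\sum_x w x * \1_S x)%:E.
Proof.
rewrite -sum_enum -sumEFin /fin_prob /msum.
by apply: eq_bigr => i _; rewrite /atom /= /mscale /= diracE indicE.
Qed.

Let fin_prob_setT : P setT = 1%E.
Proof.
rewrite fin_probE; congr (_%:E); rewrite -[RHS]w_sum.
by apply: eq_bigr => x _; rewrite indicT mulr1.
Qed.

HB.instance Definition _ := Measure_isProbability.Build _ _ _ P fin_prob_setT.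

Let ge0_integral_fin_prob (F : fin_space x0 -> R) : (forall x, 0 <= F x) ->
  (\int[P]_x (F x)%:E = (\sum_x w x * F x)%:E)%E.
Proof.
move=> F0; rewrite /fin_prob ge0_integral_measure_sum //=; last first.
  by move=> x _; rewrite lee_fin.
rewrite -sum_enum -sumEFin; apply: eq_bigr => i _.
rewrite ge0_integral_mscale //=; last by move=> x _; rewrite lee_fin.
by rewrite integral_dirac // diracT mul1e.
Qed.

Lemma integral_fin_prob (F : fin_space x0 -> R) :
  (\int[P]_x (F x)%:E = (\sum_x w x * F x)%:E)%E.
Proof.
rewrite integralE.
have -> : (\int[P]_x ((EFin \o F)^\+ x) = \int[P]_x (Num.max (F x) 0)%:E)%E.
  by apply: eq_integral => x _; rewrite funeposE /= EFin_max.
have -> : (\int[P]_x ((EFin \o F)^\- x) = \int[P]_x (Num.max (- F x) 0)%:E)%E.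
  by apply: eq_integral => x _; rewrite funenegE /= EFin_max.
rewrite !ge0_integral_fin_prob; try by move=> x; rewrite le_max lexx orbT.
rewrite -EFinB -sumrB; congr (_%:E); apply: eq_bigr => x _.
rewrite -mulrBr; congr (_ * _).
have [h|h] := leP 0 (F x).
  by rewrite max_r ?subr0 // oppr_le0.
by rewrite max_l ?sub0r ?opprK // oppr_ge0 ltW.
Qed.

Lemma integrable_fin_prob (F : fin_space x0 -> R) :
  P.-integrable setT (EFin \o F).
Proof.
apply/integrableP; split => //.
rewrite [X in (X < _)%E](_ : _ = (\sum_x w x * `|F x|)%:E) ?ltry //.
by rewrite -integral_fin_prob; apply: eq_integral.
Qed.

End FinProb.

Arguments fin_prob {R X} x0 {w} w_ge0 _ _.

(** * Triangular weights *)

Section Triangle.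
Variable R : realType.

(** A tent with peak [n] at [n]; truncated subtraction makes it vanish from [n.*2] on. It is the
    square root of the unnormalized noise law, so products of shifted values sum to Hellinger
    affinities. *)
Definition tri (n k : nat) : nat := minn k (n.*2 - k).

Lemma tri0 n : tri n 0 = 0%N. Proof. by rewrite /tri min0n. Qed.

Lemma tri_ge n k : (n.*2 <= k)%N -> tri n k = 0%N.
Proof. by rewrite -subn_eq0 /tri => /eqP ->; rewrite minn0. Qed.

(** Completing the square leaves the squared increment of the tent, which is 1 before [n.*2] and 0
    afterwards. *)
Lemma tri_step n k : (tri n k.+1)%:R ^+ 2 + (tri n k)%:R ^+ 2 <=
  2 * ((tri n k)%:R * (tri n k.+1)%:R) + (k < n.*2)%:R :> R.
Proof.
have [kn|nk] := ltnP k n.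
  have -> : tri n k = k by rewrite /tri; lia.
  have -> : tri n k.+1 = k.+1 by rewrite /tri; lia.
  have -> : (k < n.*2)%N by lia.
  by rewrite -(natr1 k) /=; nra.
have [kn2|n2k] := ltnP k n.*2; last first.
  by rewrite !tri_ge // ?(leqW n2k) // !expr0n !mul0r mulr0 addr0.
have -> : tri n k = (tri n k.+1).+1 by rewrite /tri; lia.
by rewrite -(natr1 (tri n k.+1)) /=; nra.
Qed.

Definition tri_mass (M n : nat) : R := \sum_(k < M) (tri n k)%:R ^+ 2.

(** Index [k < n] is paired with [k + n], where the tent is [n - k], and
    [k ^+ 2 + (n - k) ^+ 2 >= n ^+ 2 / 2]. *)
Lemma tri_mass_ge M n : (n.*2 <= M)%N -> n%:R ^+ 3 / 2 <= tri_mass M n.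
Proof.
move=> nM; rewrite /tri_mass -(big_mkord xpredT (fun k => (tri n k)%:R ^+ 2)).
rewrite (big_cat_nat _ nM) //=.
apply: (@le_trans _ _ (\sum_(0 <= k < n.*2) (tri n k)%:R ^+ 2)); last first.
  by rewrite lerDl sumr_ge0 // => k _; rewrite sqr_ge0.
rewrite -addnn (big_cat_nat _ (leq_addr n n)) //=.
rewrite -{4}[n]addn0 addnC big_addn addnK -big_split /=.
rewrite [leLHS](_ : _ = \sum_(0 <= k < n) (n%:R ^+ 2 / 2)); last first.
  by rewrite big_const_nat iter_addr_0 subn0 -mulr_natl; field.
apply: ler_sum_nat => k /andP[_ kn].
have -> : tri n k = k by rewrite /tri; lia.
have -> : tri n (k + n) = (n - k)%N by rewrite /tri; lia.
rewrite natrB ?(ltnW kn) //.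
by have := sqr_ge0 (n%:R - 2 * k%:R : R); nra.
Qed.

(** Summing [tri_step] bounds the lost overlap by [n], which by [tri_mass_ge] is at most a fraction
    [2 / n ^+ 2] of the mass. *)
Lemma tri_overlap M n : (0 < n)%N -> (n.*2 <= M)%N ->
  tri_mass M.+1 n * (1 - 2 / n%:R ^+ 2) <=
  \sum_(k < M) ((tri n k)%:R * (tri n k.+1)%:R).
Proof.
move=> n0 nM.
have ZM : tri_mass M.+1 n = \sum_(k < M) (tri n k)%:R ^+ 2.
  by rewrite /tri_mass big_ord_recr /= tri_ge // expr0n addr0.
have ZM' : tri_mass M.+1 n = \sum_(k < M) (tri n k.+1)%:R ^+ 2.
  by rewrite /tri_mass big_ord_recl /= tri0 expr0n add0r; apply: eq_bigr.
have H : 2 * tri_mass M.+1 n <=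
    2 * \sum_(k < M) ((tri n k)%:R * (tri n k.+1)%:R) + (n.*2)%:R.
  have -> : (n.*2)%:R = \sum_(k < M) (k < n.*2)%:R :> R.
    rewrite -natr_sum -(big_mkord xpredT (fun k => (k < n.*2)%N : nat)).
    rewrite (big_cat_nat _ nM) //= !big_nat.
    rewrite (eq_bigr (fun=> 1%N)); last by move=> k /andP[_ ->].
    rewrite -big_nat sum_nat_const_nat subn0 muln1.
    by rewrite big1 ?addn0 // => k /andP[h _]; rewrite ltnNge h.
  have -> : 2 * tri_mass M.+1 n = \sum_(k < M) (tri n k.+1)%:R ^+ 2 +
      \sum_(k < M) (tri n k)%:R ^+ 2 by rewrite -ZM -ZM'; ring.
  rewrite mulr_sumr -!big_split /=.
  by apply: ler_sum => k _; exact: tri_step.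
have nR : 0 < n%:R :> R by rewrite ltr0n.
have Zge := tri_mass_ge (leqW nM).
have : n%:R <= tri_mass M.+1 n * (2 / n%:R ^+ 2).
  by rewrite mulrA ler_pdivlMr ?exprn_gt0 //; nra.
rewrite -muln2 natrM in H.
lra.
Qed.

(** The law lives on [M.+1] points whatever [n] is, so that the noises of all coordinates share one
    finite alphabet. *)
Definition tri_prob (M n k : nat) : R := (tri n k)%:R ^+ 2 / tri_mass M.+1 n.

Lemma tri_mass_gt0 M n : (0 < n)%N -> (n.*2 <= M)%N -> 0 < tri_mass M.+1 n.
Proof.
move=> n0 nM; apply: lt_le_trans (tri_mass_ge (leqW nM)).
by rewrite divr_gt0 // exprn_gt0 // ltr0n.
Qed.

Lemma tri_prob_ge0 M n k : 0 <= tri_prob M n k.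
Proof. by rewrite divr_ge0 ?sqr_ge0 ?sumr_ge0 // => i _; rewrite sqr_ge0. Qed.

Lemma tri_prob_sum M n : (0 < n)%N -> (n.*2 <= M)%N ->
  \sum_(k < M.+1) tri_prob M n k = 1.
Proof. by move=> n0 nM; rewrite -mulr_suml divff // gt_eqF // tri_mass_gt0. Qed.

Lemma tri_prob_mean M n : (n.*2 <= M)%N ->
  \sum_(k < M.+1) tri_prob M n k * (k%:R - n%:R) = 0.
Proof.
move=> nM; pose F k := tri_prob M n k * (k%:R - n%:R).
rewrite -(big_mkord xpredT F) (@big_cat_nat _ _ _ n.*2.+1) //=.
rewrite [X in _ + X]big1_seq ?addr0; last first.
  move=> k /andP[_]; rewrite mem_index_iota => /andP[h _].
  by rewrite /F /tri_prob tri_ge ?(ltnW h) // expr0n mul0r mul0r.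
(* The reflection [k -> n.*2 - k] fixes the weights and negates the deviations. *)
set s := (X in X = 0); suff : s = - s by lra.
rewrite /s [LHS]big_nat_rev /= add0n [LHS]big_mkord big_mkord -sumrN.
apply: eq_bigr => [[k /= kn]] _.
rewrite /F /tri_prob subSS -mulrN opprB.
have -> : tri n (n.*2 - k) = tri n k by rewrite /tri; lia.
rewrite natrB; last by lia.
by rewrite -addnn natrD; congr (_ * _); ring.
Qed.

Lemma tri_prob_supp M n k : tri_prob M n k != 0 -> (k < n.*2)%N.
Proof.
by apply: contraNT; rewrite -leqNgt => h; rewrite /tri_prob tri_ge // expr0n mul0r.
Qed.

End Triangle.

(** * Two-point comparison along histories *)

Section TwoPoint.
Variable R : realType.

(* [x] and [y] are risks under two hypotheses; [u^2] and [v^2] play the role of the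
   likelihoods of an observation under them, and [u * v] of its Hellinger affinity. *)
Definition two_point (D x y : R) :=
  forall u v, 0 <= u -> 0 <= v ->
  D * (4 * u * v - u ^+ 2 - v ^+ 2) <= u ^+ 2 * x + v ^+ 2 * y.

(** The first square in the proof vanishes at the optimal prediction [p], where the right side
    equals [4 * delta ^+ 2 * u ^+ 2 * v ^+ 2 / (u ^+ 2 + v ^+ 2)]; the second bounds this minimum
    below by an expression linear in the affinity [u * v]. *)
Lemma two_point_sqr (p delta : R) :
  two_point (delta ^+ 2) ((p - delta) ^+ 2) ((p + delta) ^+ 2).
Proof.
move=> u v _ _; have [->|u0] := eqVneq u 0; first by nra.
have s0 : 0 < u ^+ 2 + v ^+ 2.
  by rewrite ltr_wpDr ?sqr_ge0 // lt_neqAle sqr_ge0 eq_sym sqrf_eq0 u0.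
rewrite -(ler_pM2l s0) -subr_ge0.
rewrite [X in 0 <= X](_ : _ = (p * (u ^+ 2 + v ^+ 2) - delta * (u ^+ 2 - v ^+ 2)) ^+ 2
    + (delta * (2 * u * v - (u ^+ 2 + v ^+ 2))) ^+ 2); last by ring.
by rewrite addr_ge0 ?sqr_ge0.
Qed.

(** This is a query in another coordinate: the label has the same law under both hypotheses, so the
    bound averages at no cost. *)
Lemma two_point_mix (Y : finType) (D : R) (w G1 G0 : Y -> R) :
  (forall k, 0 <= w k) -> \sum_k w k = 1 ->
  (forall k, two_point D (G1 k) (G0 k)) ->
  two_point D (\sum_k w k * G1 k) (\sum_k w k * G0 k).
Proof.
move=> w0 w1 H u v u0 v0.
rewrite [leLHS](_ : _ = \sum_k w k * (D * (4 * u * v - u ^+ 2 - v ^+ 2))); last first.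
  by rewrite -mulr_suml w1 mul1r.
rewrite !mulr_sumr -big_split /=.
apply: ler_sum => k _.
have := ler_wpM2l (w0 k) (H k u v u0 v0).
lra.
Qed.

(** This is a query in the tested coordinate, where the hypotheses shift the index by one. Index
    [k.+1] has square-root likelihoods proportional to [tri n k] and [tri n k.+1]; the affinity
    deficit costs at most [8 * D * u * v / n ^+ 2], repaid by the charge [4 * D / n ^+ 2] since
    [2 * u * v <= u ^+ 2 + v ^+ 2]. *)
Lemma two_point_tri (M n : nat) (D : R) (G1 G0 : nat -> R) :
  (0 < n)%N -> (n.*2 <= M)%N -> 0 <= D ->
  (forall k, two_point D (G1 k) (G0 k)) ->
  two_point D (4 * D / n%:R ^+ 2 + \sum_(k < M.+1) tri_prob R M n k * G1 k.+1)
              (4 * D / n%:R ^+ 2 + \sum_(k < M.+1) tri_prob R M n k * G0 k).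
Proof.
move=> n0 nM D0 H u v u0 v0.
have Z0 := tri_mass_gt0 R n0 nM; set Z := tri_mass R M.+1 n in Z0.
have nR : 0 < n%:R ^+ 2 :> R by rewrite exprn_gt0 // ltr0n.
have ZM : Z = \sum_(k < M) (tri n k)%:R ^+ 2.
  by rewrite /Z /tri_mass big_ord_recr /= tri_ge // expr0n addr0.
have ZM' : Z = \sum_(k < M) (tri n k.+1)%:R ^+ 2.
  by rewrite /Z /tri_mass big_ord_recl /= tri0 expr0n add0r; apply: eq_bigr.
have S1 : Z * (\sum_(k < M.+1) tri_prob R M n k * G1 k.+1) =
          \sum_(k < M) (tri n k)%:R ^+ 2 * G1 k.+1.
  rewrite big_ord_recr /= {2}/tri_prob tri_ge // expr0n !mul0r addr0 mulr_sumr.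
  by apply: eq_bigr => k _; rewrite /tri_prob mulrA (mulrC Z) divfK // gt_eqF.
have S0 : Z * (\sum_(k < M.+1) tri_prob R M n k * G0 k) =
          \sum_(k < M) (tri n k.+1)%:R ^+ 2 * G0 k.+1.
  rewrite big_ord_recl /= {1}/tri_prob tri0 expr0n !mul0r add0r mulr_sumr.
  by apply: eq_bigr => k _; rewrite /tri_prob mulrA (mulrC Z) divfK // gt_eqF.
have main : D * (4 * u * v * (\sum_(k < M) (tri n k)%:R * (tri n k.+1)%:R)
                 - u ^+ 2 * Z - v ^+ 2 * Z) <=
    u ^+ 2 * \sum_(k < M) (tri n k)%:R ^+ 2 * G1 k.+1 +
    v ^+ 2 * \sum_(k < M) (tri n k.+1)%:R ^+ 2 * G0 k.+1.
  rewrite {1}ZM ZM' !mulr_sumr -!sumrB mulr_sumr -big_split /=.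
  apply: ler_sum => k _.
  have := H k.+1 (u * (tri n k)%:R) (v * (tri n k.+1)%:R).
  by rewrite !mulr_ge0 // => /(_ isT isT); lra.
have ov := tri_overlap R n0 nM; rewrite -/Z in ov.
rewrite -(ler_pM2l Z0).
set A1 := \sum_(k < M.+1) _ in S1 *; set A0 := \sum_(k < M.+1) _ in S0 *.
have Duv : 0 <= D * (u * v) by rewrite !mulr_ge0.
have := ler_wpM2l Duv ov.
set q := n%:R ^+ 2 in nR *; set O := \sum_(k < M) _ in main *.
have q0 : 0 <= 4 * D / q * Z by rewrite !mulr_ge0 // ?invr_ge0 ltW.
rewrite -S1 -S0 in main.
have sq : 0 <= 4 * D / q * Z * (u - v) ^+ 2 by rewrite mulr_ge0 ?sqr_ge0.
move: main sq; rewrite -!mulrA; set iq := q^-1 => main sq h.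
have e1 : D * (u * v * (Z * (1 - 2 * iq))) =
    D * u * v * Z - 2 * (D * iq * Z * (u * v)) by ring.
nra.
Qed.

Section Risk.
Variables (A : Type) (L : learner R A) (a : A) (Y : finType).

(* Expected cost over the next [n] rounds after history [h], whose length is the
   current time: [c] is paid at each query and [F] on the final history. *)
Fixpoint risk (lab w : nat -> Y -> R) (c : nat -> R)
    (F : seq (option R) -> R) (n : nat) (h : seq (option R)) : R :=
  if n is n'.+1 then
    if lquery L (size h) a h then
      c (size h) + \sum_k w (size h) k *
        risk lab w c F n' (rcons h (Some (lab (size h) k)))
    else risk lab w c F n' (rcons h None)
  else F h.

(** Backward induction: the decision depends only on the seed and the history, so after a given
    history both hypotheses query or neither does, and an unqueried round appends [None] in both. *)
Lemma two_point_risk (D : R) (lab1 lab0 w : nat -> Y -> R) (c : nat -> R)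
    (F1 F0 : seq (option R) -> R) :
  (forall h, two_point D (F1 h) (F0 h)) ->
  (forall s (G1 G0 : R -> R), (forall l, two_point D (G1 l) (G0 l)) ->
     two_point D (c s + \sum_k w s k * G1 (lab1 s k))
                 (c s + \sum_k w s k * G0 (lab0 s k))) ->
  forall n h, two_point D (risk lab1 w c F1 n h) (risk lab0 w c F0 n h).
Proof.
move=> HF Hstep; elim=> [|n IH] h //=; case: ifP => _ //.
exact: (Hstep (size h) (fun l => risk lab1 w c F1 n (rcons h (Some l)))
                       (fun l => risk lab0 w c F0 n (rcons h (Some l)))).
Qed.

Lemma size_hist (y : nat -> R) t : size (hist L a y t) = t.
Proof. by elim: t => //= t IH; rewrite size_rcons IH. Qed.

Lemma eq_hist (y y' : nat -> R) t : (forall s, (s < t)%N -> y s = y' s) ->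
  hist L a y t = hist L a y' t.
Proof.
elim: t => //= t IH H; rewrite IH ?H // => s st.
by apply: H; rewrite ltnS ltnW.
Qed.

End Risk.

(** [G f] ignores the value of [f] at [t], so that value may be replaced by a fresh copy: swapping
    [f t] with [z] is an involution preserving the joint weight. *)
Lemma resample (I Y : finType) (w : I -> Y -> R) (t : I)
    (G : {ffun I -> Y} -> Y -> R) :
  \sum_y w t y = 1 ->
  (forall (f : {ffun I -> Y}) y, G [ffun s => if s == t then y else f s] =1 G f) ->
  \sum_(f : {ffun I -> Y}) (\prod_s w s (f s)) * G f (f t) =
  \sum_(f : {ffun I -> Y}) (\prod_s w s (f s)) * \sum_z w t z * G f z.
Proof.
move=> w1 GE.
pose upd (f : {ffun I -> Y}) y := [ffun s => if s == t then y else f s].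
pose phi (p : {ffun I -> Y} * Y) := (upd p.1 p.2, p.1 t).
have phiK : involutive phi.
  case=> f y; rewrite /phi /=; congr pair; last by rewrite ffunE eqxx.
  by apply/ffunP => s; rewrite !ffunE; case: eqP => [->|].
transitivity (\sum_(f : {ffun _ -> _}) \sum_z (\prod_s w s (f s)) * G f (f t) * w t z).
  by apply: eq_bigr => f _; rewrite -mulr_sumr w1 mulr1.
rewrite pair_bigA (reindex_inj (inv_inj phiK)) /=.
under [RHS]eq_bigr do rewrite mulr_sumr.
rewrite [RHS]pair_bigA; apply: eq_bigr => -[f z] _ /=.
rewrite GE ffunE eqxx (bigD1 t) //= [in RHS](bigD1 t) //= ffunE eqxx.
rewrite (eq_bigr (fun s => w s (f s))); first by ring.
by move=> s st; rewrite ffunE (negbTE st).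
Qed.

(** * Recursive risk as an expectation over noise sequences *)

Section RiskExpectation.
Variables (A : Type) (L : learner R A) (a : A) (Y : finType) (T : nat).
Variables (lab w : nat -> Y -> R) (c : nat -> R) (F : seq (option R) -> R).
Hypothesis w1 : forall s, \sum_k w s k = 1.
Let y (f : {ffun 'I_T.+1 -> Y}) s := lab s (f (inord s)).

(** Induction on the rounds left, peeling off round [s]: the history before [s] does not involve the
    index drawn at [s], so [resample] applies. *)
Let risk_expectation_from n s : (s + n <= T.+1)%N ->
  \sum_(f : {ffun 'I_T.+1 -> Y}) (\prod_(t < T.+1) w t (f t)) *
    (\sum_(s <= r < s + n) c r * (queried L a (y f) r)%:R +
     F (hist L a (y f) (s + n))) =
  \sum_(f : {ffun 'I_T.+1 -> Y}) (\prod_(t < T.+1) w t (f t)) *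
    risk L a lab w c F n (hist L a (y f) s).
Proof.
elim: n s => [|n IH] s sT.
  by apply: eq_bigr => f _; rewrite addn0 big_geq // add0r.
have sT' : (s < T.+1)%N by rewrite (leq_trans _ sT) // addnS ltnS leq_addr.
have svE : nat_of_ord (inord s : 'I_T.+1) = s by rewrite inordK.
pose h (f : {ffun 'I_T.+1 -> Y}) := hist L a (y f) s.
pose q f := lquery L s a (h f).
pose G f z := risk L a lab w c F n
  (rcons (h f) (if q f then Some (lab s z) else None)).
have GE (f : {ffun 'I_T.+1 -> Y}) z : G [ffun t => if t == inord s then z else f t] =1 G f.
  have hE : h [ffun t => if t == inord s then z else f t] = h f.
    apply: eq_hist => r rs; rewrite /y ffunE ifN //.
    apply/eqP => /(congr1 val) /=; rewrite !inordK ?(ltn_trans rs) // => E.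
    by rewrite E ltnn in rs.
  by move=> z'; rewrite /G /q hE.
have := @resample _ _ (fun t : 'I_T.+1 => w t) (inord s) G; rewrite svE.
move=> /(_ (w1 s) GE) HG.
transitivity (\sum_(f : {ffun _ -> _}) (\prod_(t < T.+1) w t (f t)) * (c s * (q f)%:R) +
    \sum_(f : {ffun _ -> _}) (\prod_(t < T.+1) w t (f t)) * G f (f (inord s))).
  have GhE f : G f (f (inord s)) = risk L a lab w c F n (hist L a (y f) s.+1).
    by rewrite /G /h /q /=; case: ifP.
  under [X in _ = _ + X]eq_bigr do rewrite GhE.
  rewrite -IH ?addSnnS // -big_split /=; apply: eq_bigr => f _.
  by rewrite -mulrDr big_ltn ?addnS ?ltnS ?leq_addr // addrA.
rewrite HG -big_split /=; apply: eq_bigr => f _; rewrite -mulrDr; congr (_ * _).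
rewrite size_hist -/(h f) -/(q f) /G; case: (q f); first by rewrite mulr1.
by rewrite mulr0 add0r -mulr_suml w1 mul1r.
Qed.

Lemma risk_expectation n : (n <= T.+1)%N ->
  \sum_(f : {ffun 'I_T.+1 -> Y}) (\prod_(t < T.+1) w t (f t)) *
    (\sum_(0 <= r < n) c r * (queried L a (y f) r)%:R + F (hist L a (y f) n)) =
  risk L a lab w c F n [::].
Proof.
move=> nT; have := @risk_expectation_from n 0%N nT; rewrite add0n => ->.
rewrite /= -mulr_suml -(bigA_distr_bigA (fun (t : 'I_T.+1) k => w t k)).
by rewrite big1 ?mul1r // => t _; exact: w1.
Qed.

End RiskExpectation.
End TwoPoint.

(** * The adversary *)

Section Adversary.
Variables (R : realType) (d T M : nat) (cd : nat -> 'I_d) (nn : 'I_d -> nat).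
Hypotheses (nn_gt0 : forall i, (0 < nn i)%N) (nn_le : forall i, ((nn i).*2 <= M)%N).

(** The factor 4 keeps the noise within [2 * gap i * (nn i)%:R = 1 / 2] of zero at every resolution
    [nn i]. *)
Definition gap i : R := (4 * (nn i)%:R)^-1.

Definition sign_param (sg : {ffun 'I_d -> bool}) : 'rV[R]_d :=
  \row_i (if sg i then gap i else - gap i).

Definition input s : 'rV[R]_d := delta_mx ord0 (cd s).

Definition lattice_noise i (k : nat) : R := 2 * gap i * (k%:R - (nn i)%:R).

Let outcome : finType := ({ffun 'I_d -> bool} * {ffun 'I_T.+1 -> 'I_M.+1})%type.

Definition outcome0 : outcome := ([ffun=> true], [ffun=> ord0]).

Definition noise_weight (f : {ffun 'I_T.+1 -> 'I_M.+1}) : R :=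
  \prod_(t < T.+1) tri_prob R M (nn (cd t)) (f t).

Definition weight (e : outcome) : R := (2 ^+ d)^-1 * noise_weight e.2.

Definition noise_at s (e : outcome) : R := lattice_noise (cd s) (e.2 (inord s)).

Lemma gap_gt0 i : 0 < gap i.
Proof. by rewrite invr_gt0 mulr_gt0 // ltr0n. Qed.

Lemma gapK i : 4 * gap i * (nn i)%:R = 1.
Proof. by rewrite /gap invfM mulrA divff ?pnatr_eq0 // mul1r mulVf // pnatr_eq0 -lt0n. Qed.

Lemma gap_le i : gap i <= 1 / 4.
Proof.
have := gapK i; have := gap_gt0 i.
have : 1 <= (nn i)%:R :> R by rewrite ler1n.
nra.
Qed.

Lemma inner_input (u : 'rV[R]_d) s : inner u (input s) = u ord0 (cd s).
Proof.
rewrite /inner (bigD1 (cd s)) //= mxE !eqxx mulr1 big1 ?addr0 // => i ics.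
by rewrite mxE (negbTE ics) andbF mulr0.
Qed.

Lemma sign_param_norm sg i : `|sign_param sg ord0 i| = gap i.
Proof.
by rewrite mxE; case: ifP; rewrite ?normrN gtr0_norm // gap_gt0.
Qed.

Lemma norm2_sign_param sg : norm2 (sign_param sg) <= Num.sqrt d%:R.
Proof.
rewrite /norm2 ler_wsqrtr // /inner -[in leRHS](card_ord d) -sum1_card natr_sum.
apply: ler_sum => i _; rewrite -expr2 -real_normK ?num_real // sign_param_norm.
have := gap_le i; have := gap_gt0 i; nra.
Qed.

Lemma norm2_input s : norm2 (input s) <= 1.
Proof. by rewrite /norm2 inner_input mxE !eqxx sqrtr1. Qed.

Lemma lattice_noise_le i (k : nat) : (k <= (nn i).*2)%N ->
  lattice_noise i k ^+ 2 <= 1 / 4.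
Proof.
move=> kn; have := gapK i; have := gap_gt0 i; rewrite /lattice_noise.
have k0 : 0 <= k%:R :> R by [].
have : k%:R <= 2 * (nn i)%:R :> R by rewrite -natrM ler_nat mul2n.
set g := gap i; set n := (nn i)%:R; set x := k%:R => xn g0 gn.
have e : 2 * g * n = 1 / 2 by lra.
have -> : 1 / 4 = (2 * g * n) ^+ 2 by rewrite e; field.
have : 0 <= (2 * g) ^+ 2 * (x * (2 * n - x)).
  by apply: mulr_ge0; [exact: sqr_ge0|apply: mulr_ge0 => //; rewrite subr_ge0].
nra.
Qed.

Lemma sum_outcome (F : outcome -> R) : \sum_e F e = \sum_sg \sum_f F (sg, f).
Proof. by rewrite pair_bigA; apply: eq_bigr => -[]. Qed.

(** Signs and noise indices form a product space. Total mass, both marginals and independence are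
    instances of this factorization. *)
Lemma expect_prod (g : {ffun 'I_d -> bool} -> R) (h : 'I_T.+1 -> 'I_M.+1 -> R) :
  \sum_e weight e * (g e.1 * \prod_t h t (e.2 t)) =
  (\sum_sg (2 ^+ d)^-1 * g sg) *
  \prod_(t < T.+1) \sum_(k < M.+1) tri_prob R M (nn (cd t)) k * h t k.
Proof.
rewrite (bigA_distr_bigA (fun (t : 'I_T.+1) (k : 'I_M.+1) =>
  tri_prob R M (nn (cd t)) k * h t k)).
rewrite mulr_suml sum_outcome /=.
apply: eq_bigr => sg _; rewrite mulr_sumr; apply: eq_bigr => f _.
by rewrite big_split /= /weight /noise_weight /=; ring.
Qed.

Lemma sum_sign_weight : \sum_(sg : {ffun 'I_d -> bool}) (2 ^+ d)^-1 = 1 :> R.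
Proof.
by rewrite sumr_const card_ffun card_bool card_ord -(mulr_natl _ (2 ^ d)) natrX mulfV.
Qed.

Lemma expect_sign (g : {ffun 'I_d -> bool} -> R) :
  \sum_e weight e * g e.1 = \sum_sg (2 ^+ d)^-1 * g sg.
Proof.
have := expect_prod g (fun _ _ => 1); rewrite [X in _ * X]big1 ?mulr1 => [<-|t _].
  by apply: eq_bigr => e _; rewrite big1 // mulr1.
by under eq_bigr do rewrite mulr1; exact: tri_prob_sum.
Qed.

Lemma weight_sum : \sum_e weight e = 1.
Proof.
under eq_bigr do rewrite -[weight _]mulr1.
by rewrite (expect_sign (fun=> 1)) -mulr_suml sum_sign_weight mulr1.
Qed.

Lemma weight_ge0 e : 0 <= weight e.
Proof.
rewrite mulr_ge0 ?invr_ge0 ?exprn_ge0 // prodr_ge0 // => t _.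
exact: tri_prob_ge0.
Qed.

Lemma expect_noise (t : 'I_T.+1) (h : 'I_M.+1 -> R) :
  \sum_e weight e * h (e.2 t) = \sum_(k < M.+1) tri_prob R M (nn (cd t)) k * h k.
Proof.
have := expect_prod (fun=> 1) (fun s k => if s == t then h k else 1).
rewrite -mulr_suml sum_sign_weight !mul1r [X in _ = X](bigD1 t) //= eqxx.
rewrite [X in _ = _ * X]big1 ?mulr1 => [<-|s /negbTE ->]; last first.
  by under eq_bigr do rewrite mulr1; exact: tri_prob_sum.
apply: eq_bigr => e _; rewrite mul1r (bigD1 t) //= eqxx big1 ?mulr1 //.
by move=> s /negbTE ->.
Qed.

Definition adversary_prob : probability (fin_space outcome0) R :=
  fin_prob outcome0 weight_ge0 weight_sum.

Lemma adversary_subgaussian (eta : R) (t : 'I_T.+1) : 1 <= eta ->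
  zero_mean_subgaussian adversary_prob (noise_at t) (eta ^+ 2).
Proof.
move=> eta1.
have mean0 : \sum_(k < M.+1) tri_prob R M (nn (cd t)) k * lattice_noise (cd t) k = 0.
  transitivity (2 * gap (cd t) * \sum_(k < M.+1)
      tri_prob R M (nn (cd t)) k * (k%:R - (nn (cd t))%:R)).
    by rewrite mulr_sumr; apply: eq_bigr => k _; rewrite /lattice_noise; ring.
  by rewrite tri_prob_mean // mulr0.
split; first exact: fin_space_measurable_fun.
split; first exact: integrable_fin_prob.
split.
  rewrite integral_fin_prob /noise_at inord_val.
  by rewrite (expect_noise t (fun k => lattice_noise (cd t) k)) mean0.
move=> lam; rewrite integral_fin_prob /noise_at inord_val lee_fin.
rewrite (expect_noise t (fun k => expR (lam * lattice_noise (cd t) k))).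
apply: (@le_trans _ _ (\sum_(k < M.+1)
    (lam * (tri_prob R M (nn (cd t)) k * lattice_noise (cd t) k) +
     tri_prob R M (nn (cd t)) k * expR (lam ^+ 2 * eta ^+ 2 / 2)))); last first.
  by rewrite big_split /= -mulr_sumr mean0 mulr0 add0r -mulr_suml tri_prob_sum // mul1r.
(* On the support the noise [z] satisfies [z ^+ 2 <= 1 / 4], so [2 * (lam * z) ^+ 2 <= lam ^+ 2 *
   eta ^+ 2 / 2]. *)
apply: ler_sum => k _; have [->|/tri_prob_supp kn] := eqVneq (tri_prob R M (nn (cd t)) k) 0.
  by rewrite !mul0r mulr0 addr0.
rewrite [X in _ <= X + _]mulrCA -mulrDr ler_wpM2l ?tri_prob_ge0 //.
apply: le_trans (expR_le_linear_sqr _) _; rewrite lerD2l ler_expR.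
have := @lattice_noise_le (cd t) k (ltnW kn).
move=> hz; rewrite [(_ * lattice_noise _ _) ^+ 2]exprMn.
have h1 : 1 <= eta ^+ 2 by rewrite expr_ge1 // (le_trans _ eta1).
have := ler_wpM2l (sqr_ge0 lam) h1; have := ler_wpM2l (sqr_ge0 lam) hz.
lra.
Qed.

Lemma adversary_indep :
  indep_theta_noise adversary_prob T.+1 (fun e => sign_param e.1) noise_at.
Proof.
move=> C S _ _.
have PE (B : set (fin_space outcome0)) :
    adversary_prob B = (\sum_e weight e * \1_B e)%:E by exact: fin_probE.
rewrite !PE /=.
pose g (sg : {ffun 'I_d -> bool}) : R := \1_[set sg | forall i, C i (sign_param sg ord0 i)] sg.
pose h (t : 'I_T.+1) (k : 'I_M.+1) : R := \1_(S t) (lattice_noise (cd t) k).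
have -> : \sum_x weight x * \1_[set e : outcome | forall i, C i (sign_param e.1 ord0 i)] x
    = \sum_sg (2 ^+ d)^-1 * g sg by rewrite -expect_sign; apply: eq_bigr.
rewrite [X in _ = _ * X](eq_bigr (fun t : 'I_T.+1 =>
    \sum_(k < M.+1) tri_prob R M (nn (cd t)) k * h t k)).
  rewrite -expect_prod; apply: eq_bigr => e _; congr (_ * _).
  rewrite indicI /=; congr (_ * _).
  rewrite /h; have [H|/existsNP[t H]] := pselect (forall t : 'I_T.+1, S t (noise_at t e)).
    rewrite indicE mem_set // big1 // => t _; rewrite indicE mem_set //.
    by have := H t; rewrite /noise_at inord_val.
  rewrite (bigD1 t) //= !indicE !memNset ?mul0r //.
  by move: H; rewrite /noise_at inord_val.
move=> t _; rewrite PE /= -expect_noise; apply: eq_bigr => e _; congr (_ * _).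
by rewrite /h !indicE /noise_at /=; congr (_ : bool)%:R; apply/idP/idP;
  rewrite !inE /= inord_val.
Qed.

(** * Lower bounds for a learner with a fixed seed *)

Section Learner.
Variables (A : Type) (L : learner R A) (a : A).

Local Notation run_labels e :=
  (labels (sign_param e.1) input (fun s => noise_at s e)).

Let sign_flip i (sg : {ffun 'I_d -> bool}) : {ffun 'I_d -> bool} :=
  [ffun j => if j == i then ~~ sg j else sg j].

Let sign_flipK i : involutive (sign_flip i).
Proof.
by move=> sg; apply/ffunP => j; rewrite !ffunE; case: eqP => //; rewrite negbK.
Qed.

(** The charge of [two_point_tri] for [D = gap ^+ 2], rewritten with [1 / n = 4 * gap]; queries in
    other coordinates are free. *)
Let round_cost t r : R := if cd r == cd t then 64 * gap (cd t) ^+ 4 else 0.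

Let Phi (t : nat) sg := \sum_f noise_weight f *
  (\sum_(0 <= r < t) round_cost t r * (queried L a (run_labels (sg, f)) r)%:R +
   (prediction L a (run_labels (sg, f)) t - sign_param sg ord0 (cd t)) ^+ 2).

Let Phi_two_point t (sg : {ffun 'I_d -> bool}) : (t <= T)%N -> sg (cd t) ->
  two_point (gap (cd t) ^+ 2) (Phi t sg) (Phi t (sign_flip (cd t) sg)).
Proof.
move=> tT sgt; set i := cd t; set sg' := sign_flip i sg.
pose lab (s : {ffun 'I_d -> bool}) r (k : 'I_M.+1) :=
  inner (sign_param s) (input r) + lattice_noise (cd r) k.
pose w r (k : 'I_M.+1) := tri_prob R M (nn (cd r)) k.
have w1 r : \sum_k w r k = 1 by exact: tri_prob_sum.
have PhiE s : Phi t s = risk L a (lab s) w (round_cost t)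
    (fun h => (lpred L t a h - sign_param s ord0 i) ^+ 2) t [::].
  by rewrite -(@risk_expectation _ _ _ _ _ T) // (leq_trans tT).
have sgi : sign_param sg ord0 i = gap i by rewrite mxE sgt.
have sgi' : sign_param sg' ord0 i = - gap i by rewrite mxE ffunE eqxx sgt.
rewrite !PhiE; apply: two_point_risk => [h|r G1 G0 HG].
  by rewrite sgi sgi' opprK; exact: two_point_sqr.
rewrite /round_cost /lab !inner_input; have [ri|ri] := eqVneq (cd r) i; last first.
  have -> : sign_param sg' ord0 (cd r) = sign_param sg ord0 (cd r).
    by rewrite !mxE ffunE (negbTE ri).
  rewrite !add0r; apply: two_point_mix => // k; exact: tri_prob_ge0.
rewrite /w ri sgi sgi'.
have -> : 64 * gap i ^+ 4 = 4 * gap i ^+ 2 / (nn i)%:R ^+ 2.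
  by rewrite /gap; field; rewrite pnatr_eq0 -lt0n.
(* Both hypotheses put the labels on this lattice: index [k] gives [lb k.+1] under the positive sign
   and [lb k] under the negative one. *)
pose lb k : R := gap i * (2 * (k%:R - (nn i)%:R) - 1).
have := @two_point_tri R M (nn i) (gap i ^+ 2) (G1 \o lb) (G0 \o lb) (nn_gt0 i)
  (nn_le i) (sqr_ge0 _) (fun k => HG _).
congr (two_point _ (_ + _) (_ + _)); apply: eq_bigr => k _; congr (_ * _) => /=.
  by congr G1; rewrite /lb /lattice_noise -natr1; ring.
by congr G0; rewrite /lb /lattice_noise; ring.
Qed.

(** At [u = v = 1] the two-point bound says that the risks at a sign vector and its flip in [cd t]
    sum to at least [2 * gap ^+ 2]; flipping is a bijection, so averaging over signs gives the
    claim. Charges after round [t] are nonnegative. *)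
Lemma round_lower_bound t : (t <= T)%N ->
  gap (cd t) ^+ 2 <= \sum_e weight e *
    ((prediction L a (run_labels e) t - inner (sign_param e.1) (input t)) ^+ 2 +
     \sum_(r < T.+1) (if cd r == cd t then 64 * gap (cd t) ^+ 4 else 0) *
        (queried L a (run_labels e) r)%:R).
Proof.
move=> tT; set D := gap (cd t) ^+ 2.
have PhiS sg : 2 * D <= Phi t sg + Phi t (sign_flip (cd t) sg).
  have [sgt|sgt] := boolP (sg (cd t)).
    by have := Phi_two_point tT sgt ler01 ler01; rewrite -/D; lra.
  have sgt' : sign_flip (cd t) sg (cd t) by rewrite ffunE eqxx.
  by have := Phi_two_point tT sgt' ler01 ler01; rewrite sign_flipK -/D; lra.
have avg : D <= \sum_sg (2 ^+ d)^-1 * Phi t sg.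
  rewrite -mulr_sumr.
  have : \sum_(sg : {ffun 'I_d -> bool}) 2 * D <= 2 * \sum_sg Phi t sg.
    have E : \sum_sg Phi t (sign_flip (cd t) sg) = \sum_sg Phi t sg.
      by rewrite [RHS](reindex_inj (inv_inj (sign_flipK (cd t)))).
    have -> : 2 * \sum_sg Phi t sg =
        \sum_sg (Phi t sg + Phi t (sign_flip (cd t) sg)).
      by rewrite big_split /= E; ring.
    by apply: ler_sum.
  rewrite -mulr_sumr ler_pM2l // => H.
  have p0 : 0 <= (2 ^+ d)^-1 :> R by rewrite invr_ge0 exprn_ge0.
  apply: le_trans (ler_wpM2l p0 H).
  by rewrite mulr_sumr -[in leRHS]mulr_suml sum_sign_weight mul1r.
apply: le_trans avg _.
rewrite [leRHS]sum_outcome /=.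
apply: ler_sum => sg _; rewrite mulr_sumr; apply: ler_sum => f _.
rewrite mulrA ler_wpM2l //; first exact: (weight_ge0 (sg, f)).
rewrite inner_input addrC lerD2l -(big_mkord xpredT
  (fun r => round_cost t r * (queried L a (run_labels (sg, f)) r)%:R)).
rewrite (big_cat_nat _ (leqW tT)) //= lerDl sumr_ge0 // => r _.
rewrite mulr_ge0 // /round_cost; case: ifP => // _.
by rewrite mulr_ge0 // exprn_ge0 // ltW // gap_gt0.
Qed.

(** Summed over [t], a query in coordinate [i] is charged [64 * gap i ^+ 4] once per round of that
    coordinate, hence at most [64 * Lam]. *)
Lemma regret_query_tradeoff (Lam : R) :
  (forall i, \sum_(t < T.+1) (cd t == i)%:R * gap i ^+ 4 <= Lam) ->
  \sum_(t < T.+1) gap (cd t) ^+ 2 <=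
  \sum_e weight e * regret L a (sign_param e.1) input (fun s => noise_at s e) T.+1 +
  64 * Lam * \sum_e weight e *
    (num_queries L a (sign_param e.1) input (fun s => noise_at s e) T.+1)%:R.
Proof.
move=> HLam; apply: le_trans.
  by apply: ler_sum => t _; apply: round_lower_bound; rewrite -ltnS.
rewrite exchange_big /= mulr_sumr -big_split /=; apply: ler_sum => e _.
rewrite -mulr_sumr big_split /= mulrDr lerD2l mulrCA ler_wpM2l ?weight_ge0 //.
rewrite exchange_big /= /num_queries natr_sum mulr_sumr; apply: ler_sum => r _.
rewrite -mulr_suml ler_wpM2r //.
apply: le_trans (ler_wpM2l _ (HLam (cd r))); last by [].
rewrite mulr_sumr; apply: ler_sum => t _.
by rewrite eq_sym; case: eqP => [->|_]; rewrite ?mul1r ?mul0r ?mulr0.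
Qed.

End Learner.
End Adversary.

(** * Calibration of the gaps *)

(** The budget holds only on average over the seed; a pointwise bound linear in [q] can still be
    integrated. *)
Lemma integral_tradeoff (R : realType) (dA : measure_display) (A : measurableType dA)
    (PA : probability A R) (r q : A -> R) (K m B : R) :
  measurable_fun setT r -> measurable_fun setT q ->
  (forall a, 0 <= r a) -> (forall a, 0 <= q a) -> 0 <= K -> 0 <= m ->
  (forall a, m <= r a + K * q a) ->
  (\int[PA]_a (q a)%:E <= B%:E)%E ->
  ((m - K * B)%:E <= \int[PA]_a (r a)%:E)%E.
Proof.
move=> mr mq r0 q0 K0 m0 H qB.
rewrite EFinB leeBlDr //.
apply: (@le_trans _ _ (\int[PA]_a ((r a)%:E + K%:E * (q a)%:E))%E); last first.
  rewrite ge0_integralD //.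
  - rewrite ge0_integralZl_EFin //; last exact/measurable_EFinP.
      by rewrite leeD2l // EFinM lee_wpmul2l // lee_fin.
    by move=> a _; rewrite lee_fin.
  - by move=> a _; rewrite lee_fin.
  - exact/measurable_EFinP.
  - by move=> a _; rewrite -EFinM lee_fin mulr_ge0.
  - by apply/measurable_EFinP; apply: measurable_funM.
have -> : m%:E = (\int[PA]_(a in setT) cst m%:E a)%E.
  by rewrite integral_cst //= probability_setT mule1.
apply: ge0_le_integral => //.
- by apply/measurable_EFinP; apply: measurable_funD => //; apply: measurable_funM.
- by move=> a _; rewrite -EFinM -EFinD lee_fin.
Qed.

(** An integer [n] just above the square root of [max 1 (1 / w)] makes the squared gap
    [min 1 w / 16] up to a factor 4. The polynomial [w - w ^+ 2 / 4] lies below [min 1 w] and is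
    easier to sum over groups. *)
Lemma resolution_exists (R : realType) (w : R) : 0 < w ->
  exists n : nat, [/\ (0 < n)%N, (4 * n%:R)^-1 ^+ 2 <= w / 16 &
    (w - w ^+ 2 / 4) / 64 <= (4 * n%:R)^-1 ^+ 2].
Proof.
move=> w0; pose z := Num.max 1 w^-1; pose s := Num.sqrt z.
have z1 : 1 <= z by rewrite le_max lexx.
have s2 : s ^+ 2 = z by rewrite sqr_sqrtr // (le_trans _ z1).
have s1 : 1 <= s by rewrite -sqrtr1 ler_wsqrtr.
have /andP[] := truncn_itv (le_trans ler01 s1); set k := Num.trunc s => ks sk.
exists k.+1; have N0 : 0 < k.+1%:R :> R by rewrite ltr0n.
have Ns : k.+1%:R <= 2 * s by rewrite -natr1; lra.
set N := k.+1%:R in N0 Ns sk *.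
have g0 : 0 < (4 * N)^-1 by rewrite invr_gt0 mulr_gt0.
have gN : (4 * N)^-1 * N = 1 / 4 by field; rewrite gt_eqF.
set g := (4 * N)^-1 in g0 gN *.
have gN2 : g ^+ 2 * N ^+ 2 = 1 / 16 by rewrite -exprMn gN; field.
have N2 : 0 < N ^+ 2 by rewrite exprn_gt0.
have zN : z <= N ^+ 2 by rewrite -s2; nra.
have Nz : N ^+ 2 <= 4 * z by rewrite -s2; nra.
split => //.
  have wN : w^-1 <= N ^+ 2 by rewrite (le_trans _ zN) // le_max lexx orbT.
  have := ler_wpM2l (ltW w0) wN; rewrite divff ?gt_eqF // => wN1.
  by rewrite -(ler_pM2r N2) gN2; lra.
rewrite -(ler_pM2r N2) gN2.
have [h|h] := leP w (w ^+ 2 / 4).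
  have : 0 <= (w ^+ 2 / 4 - w) * N ^+ 2 by rewrite mulr_ge0 ?subr_ge0 // ltW.
  lra.
have : (w - w ^+ 2 / 4) * N ^+ 2 <= (w - w ^+ 2 / 4) * (4 * z).
  by rewrite ler_wpM2l // subr_ge0 ltW.
have : (w - w ^+ 2 / 4) * z <= 1.
  rewrite /z /Num.max; case: ifP => _; last by have := sqr_ge0 (w - 2); lra.
  have -> : (w - w ^+ 2 / 4) * w^-1 = 1 - w / 4 by field; rewrite gt_eqF.
  lra.
lra.
Qed.

(** Quotients by [D] separate the members of a class, and [D * (N %/ D).+1 <= N + D <= 2 * N]. *)
Lemma card_mod_class (D N c : nat) : (0 < D <= N)%N ->
  (D * #|[set s : 'I_N | s %% D == c]%SET| <= 2 * N)%N.
Proof.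
move=> /andP[D0 DN].
have : (#|[set s : 'I_N | s %% D == c]%SET| <= (N %/ D).+1)%N.
  rewrite -[leqRHS]card_ord; set Q := [set _ | _]%SET.
  rewrite -(@card_in_imset _ _ (fun s : 'I_N => inord (s %/ D) : 'I_(N %/ D).+1) Q).
    exact: max_card.
  move=> s s'; rewrite !inE => /eqP sc /eqP sc' /(congr1 val) /=.
  rewrite !inordK ?ltnS ?leq_div2r ?(ltnW (ltn_ord _)) // => E.
  by apply: val_inj; rewrite /= (divn_eq s D) (divn_eq s' D) E sc sc'.
have := leq_trunc_div N D; nia.
Qed.

(** Rounds are pairs of a group and a position, coordinates pairs of a group and an index below
    [du u]. Position [s] uses index [s %% du u], so groups share no coordinate and each coordinate
    gets its fair share of rounds up to a factor 2. *)
Lemma group_layout (R : realType) (m d T : nat) (du Tu : 'I_m -> nat) :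
  (forall u, 0 < du u)%N -> (forall u, du u <= Tu u)%N ->
  (\sum_(u < m) du u <= d)%N -> T = (\sum_(u < m) Tu u)%N ->
  exists (grp : 'I_T -> 'I_m) (crd : 'I_T -> 'I_d),
  [/\ forall u, #|[set t | grp t == u]%SET| = Tu u,
      forall t t', crd t = crd t' -> grp t = grp t',
      forall u, exists U : 'M[R]_(du u, d), \rank U = du u /\
        forall t, grp t = u -> ((delta_mx ord0 (crd t) : 'rV_d) <= U)%MS &
      forall t, (du (grp t) * #|[set t' | crd t' == crd t]%SET| <= 2 * Tu (grp t))%N].
Proof.
move=> du0 duT dud TE.
pose J : finType := {u : 'I_m & 'I_(Tu u)}; pose K : finType := {u : 'I_m & 'I_(du u)}.
have cardS (v : 'I_m -> nat) : #|{: {u : 'I_m & 'I_(v u)}}| = (\sum_(u < m) v u)%N.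
  rewrite card_tagged sumnE big_map big_enum /=.
  by apply: eq_bigr => u _; rewrite card_ord.
have cJ : T = #|J| by rewrite TE cardS.
have cK : (#|K| <= d)%N by rewrite cardS.
pose eT (t : 'I_T) : J := enum_val (cast_ord cJ t).
have eTb : bijective eT.
  exists (fun j => cast_ord (esym cJ) (enum_rank j)) => [t|j]; rewrite /eT.
    by rewrite enum_valK cast_ordK.
  by rewrite cast_ordKV enum_rankK.
pose eK (k : K) : 'I_d := widen_ord cK (enum_rank k).
have eKi : injective eK.
  by move=> k k' /(congr1 val) /= E; apply: enum_rank_inj; apply: val_inj.
pose crdJ (j : J) : K :=
  Tagged (fun u => 'I_(du u)) (Ordinal (ltn_pmod (tagged j) (du0 (tag j)))).
exists (fun t => tag (eT t)), (fun t => eK (crdJ (eT t))).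
have card_eT (Q : pred J) : #|[set t | Q (eT t)]%SET| = (\sum_(u < m)
    #|[set s | Q (Tagged (fun u => 'I_(Tu u)) (s : 'I_(Tu u)))]%SET|)%N.
  transitivity #|[set j | Q j]%SET|.
    rewrite -(on_card_preimset (f := eT)); last exact: onW_bij.
    by apply: eq_card => t; rewrite !inE.
  rewrite -sum1_card (eq_bigr (fun u =>
      \sum_(s < Tu u | Q (Tagged (fun u => 'I_(Tu u)) s)) 1)%N).
    rewrite sig_big_dep /=; apply: eq_bigl => -[u s]; by rewrite inE.
  by move=> u _; rewrite -sum1_card; apply: eq_bigl => s; rewrite inE.
split.
- move=> u; rewrite (card_eT (fun j => tag j == u)) (bigD1 u) //= big1 ?addn0.
    by rewrite (eq_card (B := predT)) ?card_ord // => s; rewrite !inE eqxx.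
  by move=> v vu; apply: eq_card0 => s; rewrite inE (negbTE vu).
- by move=> t t' /eKi /(congr1 tag).
- move=> u; pose U : 'M[R]_(du u, d) := \matrix_(c, i)
    (i == eK (Tagged (fun u => 'I_(du u)) c))%:R.
  exists U; split.
    apply/eqP; change (row_free U); apply/row_freeP; exists U^T; apply/matrixP => c c'.
    rewrite !mxE (bigD1 (eK (Tagged (fun u => 'I_(du u)) c))) //= big1 ?addr0.
      rewrite !mxE eqxx mul1r (inj_eq eKi) eq_sym.
      by rewrite (@eq_Tagged _ (fun u => 'I_(du u)) (Tagged (fun u => 'I_(du u)) c')) eq_sym.
    by move=> i ic; rewrite !mxE (negbTE ic) mul0r.
  move=> t tu; subst u.
  set k := crdJ (eT t).
  have -> : delta_mx ord0 (eK k) = row (tagged k) U.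
    by apply/rowP => i; rewrite !mxE eqxx.
  exact: row_sub.
move=> t; set k := crdJ (eT t); set u := tag (eT t).
have -> : [set t' | eK (crdJ (eT t')) == eK k]%SET = [set t' | crdJ (eT t') == k]%SET.
  by apply/setP => t'; rewrite !inE (inj_eq eKi).
rewrite (card_eT (fun j => crdJ j == k)) (bigD1 u) //= big1 ?addn0.
  apply: leq_trans (@card_mod_class (du u) (Tu u) (tagged (eT t) %% du u) _); last first.
    by rewrite du0 duT.
  rewrite leq_mul2l; apply/orP; right; apply: subset_leq_card.
  apply/fintype.subsetP => s; rewrite !inE /k /crdJ.
  rewrite (@eq_Tagged _ (fun u => 'I_(du u)) (Tagged _ _)) /= => /eqP /(congr1 val) /= ->.
  by [].
move=> v vu; apply: eq_card0 => s; rewrite inE; apply/negbTE.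
by apply: contra vu => /eqP /(congr1 tag) /= ->.
Qed.

(** * Measurability in the learner's seed *)

Section Measurability.
Variables (R : realType) (dA dE : measure_display).
Variables (A : measurableType dA) (E : measurableType dE).
Variables (d T : nat) (theta : E -> 'rV[R]_d) (xi : nat -> E -> R) (x : nat -> 'rV[R]_d).
Variable L : learner R A.

Lemma measurable_regret (e : E) :
  (forall t : 'I_T, measurable_fun setT (fun p : A * E =>
     prediction L p.1 (labels (theta p.2) x (fun s => xi s p.2)) t)) ->
  measurable_fun setT (fun a => regret L a (theta e) x (fun s => xi s e) T).
Proof.
move=> mp; apply: measurable_sum => t.
apply: measurable_funX; apply: measurable_funB => //.
exact: (measurable_fun_pair1 e (mp t)).
Qed.

Lemma measurable_num_queries (e : E) :
  (forall t : 'I_T, measurable_fun setT (fun p : A * E =>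
     (queried L p.1 (labels (theta p.2) x (fun s => xi s p.2)) t)%:R : R)) ->
  measurable_fun setT
    (fun a => (num_queries L a (theta e) x (fun s => xi s e) T)%:R : R).
Proof.
move=> mq; under eq_fun do rewrite /num_queries natr_sum.
by apply: measurable_sum => t; exact: (measurable_fun_pair1 e (mq t)).
Qed.

End Measurability.

Section Calibration.
Variables (R : realType) (m B : nat) (du Tu : 'I_m -> nat).
Hypotheses (Tu_gt0 : forall u, (0 < Tu u)%N) (B_gt0 : (0 < B)%N).
Hypothesis du_le : (\sum_(u < m) du u <= B)%N.

Definition total : R := \sum_(u < m) Num.sqrt ((du u)%:R * (Tu u)%:R).
Definition scale : R := total / (64 * B%:R).
(* The squared gap balancing the groups; it equals [scale * sqrt (du u / Tu u)]. *)
Definition target u : R := scale * (Num.sqrt ((du u)%:R * (Tu u)%:R) / (Tu u)%:R).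

Let Tu0 u : (Tu u)%:R != 0 :> R. Proof. by rewrite pnatr_eq0 -lt0n. Qed.

Lemma target_mul u : (Tu u)%:R * target u =
  scale * Num.sqrt ((du u)%:R * (Tu u)%:R).
Proof. by rewrite /target mulrCA [X in _ * X]mulrC divfK. Qed.

Lemma target_sqr u : (Tu u)%:R * target u ^+ 2 = scale ^+ 2 * (du u)%:R.
Proof.
rewrite /target; set r := Num.sqrt _; set T := (Tu u)%:R.
have -> : T * (scale * (r / T)) ^+ 2 = scale ^+ 2 * (r ^+ 2 / T).
  by field; exact: Tu0.
by rewrite sqr_sqrtr ?mulr_ge0 // mulfK // Tu0.
Qed.

(** Weighted by [Tu u], the targets sum to [scale * total] and their squares to [scale ^+ 2] times
    the sum of the [du u], which is at most [B]. *)
Lemma total_gap_ge (g : 'I_m -> R) :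
  (forall u, (target u - target u ^+ 2 / 4) / 64 <= g u ^+ 2) ->
  (scale * total - scale ^+ 2 * B%:R / 4) / 64 <= \sum_(u < m) (Tu u)%:R * g u ^+ 2.
Proof.
move=> gH.
apply: (@le_trans _ _ (\sum_(u < m) (scale * Num.sqrt ((du u)%:R * (Tu u)%:R) -
    scale ^+ 2 * (du u)%:R / 4) / 64)).
  rewrite -mulr_suml ler_wpM2r ?invr_ge0 // sumrB -mulr_sumr lerD2l lerN2.
  rewrite -mulr_suml -mulr_sumr -natr_sum ler_wpM2r ?invr_ge0 //.
  by rewrite ler_wpM2l ?sqr_ge0 // ler_nat.
apply: ler_sum => u _; rewrite -target_mul -target_sqr.
have := ler_wpM2l (ler0n R (Tu u)) (gH u); lra.
Qed.

(** Here [n] is at most [2 * Tu u / du u] and [g ^+ 4] at most [target u ^+ 2 / 256]; by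
    [target_sqr] the group sizes cancel, leaving one bound for all coordinates. *)
Lemma count_gap_le u (n : nat) (g : R) : (du u * n <= 2 * Tu u)%N ->
  g ^+ 2 <= target u / 16 -> n%:R * g ^+ 4 <= scale ^+ 2 / 128.
Proof.
move=> dn gH; have T0 : 0 < (Tu u)%:R :> R by rewrite ltr0n.
have g4 : g ^+ 4 <= target u ^+ 2 / 256.
  have g0 := sqr_ge0 g; have -> : g ^+ 4 = (g ^+ 2) ^+ 2 by rewrite -exprM.
  by move: g0 gH; set G := g ^+ 2 => g0 gH; nra.
rewrite -(ler_pM2l T0).
have h1 := ler_wpM2l (mulr_ge0 (ler0n R n) (ltW T0)) g4.
have h2 : scale ^+ 2 * ((du u)%:R * n%:R) <= scale ^+ 2 * (2 * (Tu u)%:R).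
  by rewrite ler_wpM2l ?sqr_ge0 // -!natrM ler_nat.
have e : n%:R * (Tu u)%:R * (target u ^+ 2 / 256) = n%:R * (scale ^+ 2 * (du u)%:R) / 256.
  by rewrite -target_sqr; ring.
rewrite e in h1; lra.
Qed.

Lemma calibrated_value :
  1 / (64 * 256) * total ^+ 2 / B%:R <=
  (scale * total - scale ^+ 2 * B%:R / 4) / 64 - 64 * (scale ^+ 2 / 128) * B%:R.
Proof.
have B0 : B%:R != 0 :> R by rewrite pnatr_eq0 -lt0n.
(* In units of [q] the right side is [q - q / 256 - q / 2] and the left side [q / 4]; the 64 in
   [scale] makes the query penalty about half the gain. *)
set q := total ^+ 2 / B%:R / 64 / 64.
have q0 : 0 <= q by rewrite !divr_ge0 ?sqr_ge0.
have -> : scale * total = 64 * q by rewrite /q /scale; field; rewrite B0.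
have -> : scale ^+ 2 * B%:R = q by rewrite /q /scale; field; rewrite B0.
have -> : 64 * (scale ^+ 2 / 128) * B%:R = q / 2.
  by rewrite /q /scale; field; rewrite B0.
have -> : 1 / (64 * 256) * total ^+ 2 / B%:R = q / 4 by rewrite /q; field; rewrite B0.
lra.
Qed.

End Calibration.

Theorem theorem3 :
  forall R : realType, exists c : R, 0 < c /\
  forall (eta : R) (d m : nat) (du Tu : 'I_m -> nat) (B T : nat),
    1 <= eta -> (0 < d)%N -> (0 < m)%N ->
    (forall u, 0 < du u)%N -> (forall u, 0 < Tu u)%N ->
    (forall u, du u <= Tu u)%N ->
    (\sum_(u < m) du u <= d)%N ->
    (\sum_(u < m) du u <= B)%N ->
    T = (\sum_(u < m) Tu u)%N ->
    (* the oblivious adversary: a (prior) probability space carrying theta* and the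
       noises xi_t, and a fixed input sequence x_0, ..., x_{T-1} *)
    exists (dE : measure_display) (E : measurableType dE) (P : probability E R)
           (theta : E -> 'rV[R]_d) (xi : nat -> E -> R) (x : nat -> 'rV[R]_d),
      (* 1. ground truth and noise *)
      (forall i, measurable_fun setT (fun e => theta e ord0 i)) /\
      (forall e, norm2 (theta e) <= Num.sqrt d%:R) /\
      (forall e (t : 'I_T), `|inner (theta e) (x t)| <= 1) /\
      (forall t : 'I_T, zero_mean_subgaussian P (xi t) (eta ^+ 2)) /\
      indep_theta_noise P T theta xi /\
      (* 2. inputs and their partition into low-dimensional groups *)
      (forall t : 'I_T, norm2 (x t) <= 1) /\
      (exists I : 'I_m -> {set 'I_T},
         (forall u v, u != v -> forall t, t \in I u -> t \notin I v) /\
         (forall t, exists u, t \in I u) /\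
         (forall u, exists t, t \in I u) /\
         (forall u, #|I u| = Tu u) /\
         (forall u, exists U : 'M[R]_(du u, d),
            \rank U = du u /\ forall t, t \in I u -> (x t <= U)%MS)) /\
      (* 3. lower bound against every (measurable, possibly randomized) learner *)
      forall (dA : measure_display) (A : measurableType dA) (PA : probability A R)
             (L : learner R A),
        (forall t : 'I_T, measurable_fun setT (fun p : A * E =>
           prediction L p.1 (labels (theta p.2) x (fun s => xi s p.2)) t)) ->
        (forall t : 'I_T, measurable_fun setT (fun p : A * E =>
           (queried L p.1 (labels (theta p.2) x (fun s => xi s p.2)) t)%:R : R)) ->
        (\int[PA]_a \int[P]_e
           ((num_queries L a (theta e) x (fun s => xi s e) T)%:R : R)%:E
           <= (B%:R : R)%:E)%E ->
        ((c * (\sum_(u < m) Num.sqrt ((du u)%:R * (Tu u)%:R)) ^+ 2 / B%:R)%:E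
           <= \int[PA]_a \int[P]_e (regret L a (theta e) x (fun s => xi s e) T)%:E)%E.
Proof.
move=> R; exists (1 / (64 * 256)); split; first by lra.
move=> eta d m du Tu B T eta1 d0 m0 du0 Tu0 duT dud duB TE.
pose u0 : 'I_m := Ordinal m0.
have B0 : (0 < B)%N.
  by apply: leq_trans duB; rewrite (bigD1 u0) //= ltn_addr.
have T0 : (0 < T)%N by rewrite TE (bigD1 u0) //= ltn_addr.
case: T T0 TE => // T _ TE.
have [grp [crd [Hcard Hgrp HU Hcnt]]] := @group_layout R m d T.+1 du Tu du0 duT dud TE.
have total0 : 0 < total R du Tu.
  rewrite /total (bigD1 u0) //= ltr_wpDr //.
    by apply: sumr_ge0 => u _; exact: sqrtr_ge0.
  by rewrite sqrtr_gt0 mulr_gt0 ?ltr0n.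
have target0 u : 0 < target R B du Tu u.
  rewrite /target /scale mulr_gt0 // divr_gt0 // ?mulr_gt0 ?ltr0n //.
  by rewrite sqrtr_gt0 mulr_gt0 ?ltr0n.
have [nu Hnu] := choice (fun u => resolution_exists (target0 u)).
(* By [Hgrp] all rounds using a coordinate lie in one group, which fixes its resolution; coordinates
   used by no round get the default 1. *)
pose nn (i : 'I_d) := if [pick t | crd t == i] is Some t then nu (grp t) else 1%N.
have nnE t : nn (crd t) = nu (grp t).
  rewrite /nn; case: pickP => [t' /eqP E|/(_ t)]; first by rewrite (Hgrp _ _ E).
  by rewrite eqxx.
pose cd (s : nat) := crd (inord s).
have cdE (t : 'I_T.+1) : cd t = crd t by rewrite /cd inord_val.
pose M := (\sum_i (nn i).*2)%N.
have nn0 i : (0 < nn i)%N.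
  by rewrite /nn; case: pickP => // t _; have [] := Hnu (grp t).
have nnM i : ((nn i).*2 <= M)%N by rewrite /M (bigD1 i) //= leq_addr.
have gapE (t : 'I_T.+1) : gap R nn (cd t) = (4 * (nu (grp t))%:R)^-1.
  by rewrite /gap cdE nnE.
exists default_measure_display, (fin_space (outcome0 d T M)).
exists (@adversary_prob R d T M cd nn nn0 nnM).
exists (fun e => sign_param R nn e.1), (@noise_at R d T M cd nn), (input R cd).
split; first by move=> i; exact: fin_space_measurable_fun.
split; first by move=> e; exact: norm2_sign_param.
split.
  move=> e t; rewrite inner_input sign_param_norm //.
  by apply: le_trans (gap_le _ nn0 _) _; lra.
split; first by move=> t; exact: adversary_subgaussian.
split; first exact: adversary_indep.
split; first by move=> t; exact: norm2_input.
split.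
  exists (fun u => [set t | grp t == u]%SET); split.
    by move=> u v uv t; rewrite !inE => /eqP ->.
  split; first by move=> t; exists (grp t); rewrite inE.
  split; first by move=> u; apply/set0Pn; rewrite -card_gt0 Hcard.
  split => // u; have [U [rU HxU]] := HU u; exists U; split => // t.
  by rewrite inE => /eqP tu; rewrite /input cdE; exact: HxU.
move=> dA A PA L mp mq hq.
have Hgap : forall i, \sum_(t < T.+1) (cd t == i)%:R * gap R nn i ^+ 4 <=
    scale R B du Tu ^+ 2 / 128.
  move=> i; rewrite -mulr_suml.
  have [[t0 t0i]|no] := pselect (exists t, crd t = i); last first.
    rewrite big1 ?mul0r ?divr_ge0 ?sqr_ge0 // => t _.
    by case: eqP => // ti; case: no; exists t; rewrite -cdE.
  rewrite -natr_sum.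
  have -> : (\sum_(t < T.+1) (cd t == i) = #|[set t' | crd t' == crd t0]%SET|)%N.
    rewrite -sum1_card [RHS]big_mkcond /=; apply: eq_bigr => t _.
    by rewrite inE cdE t0i; case: eqP.
  apply: (@count_gap_le R m B du Tu Tu0 (grp t0)) => //.
  by rewrite /gap -t0i nnE; have [] := Hnu (grp t0).
have intE (F : fin_space (outcome0 d T M) -> R) :
    (\int[adversary_prob R T cd nn0 nnM]_e (F e)%:E =
     (\sum_e weight R cd nn e * F e)%:E)%E by exact: integral_fin_prob.
have intAE (F : A -> fin_space (outcome0 d T M) -> R) :
    (\int[PA]_a \int[adversary_prob R T cd nn0 nnM]_e (F a e)%:E =
     \int[PA]_a (\sum_e weight R cd nn e * F a e)%:E)%E.
  by apply: eq_integral => a _; exact: intE.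
rewrite intAE in hq; rewrite intAE.
have w0 e := @weight_ge0 R d T M cd nn e.
(* For each seed the trade-off holds with [Lam = scale ^+ 2 / 128], supplied by [Hgap]; integrating
   over seeds brings in the budget. *)
apply: le_trans (integral_tradeoff _ _ _ _ _ _
  (fun a => @regret_query_tradeoff R d T M cd nn nn0 nnM A L a
     _ Hgap) hq).
- rewrite lee_fin; apply: le_trans (calibrated_value R du Tu B0) _.
  rewrite lerD2r; apply: le_trans.
    apply: (@total_gap_ge R m B du Tu Tu0 duB (fun u => (4 * (nu u)%:R)^-1)).
    by move=> u; have [] := Hnu u.
  (* Regrouped by [grp], group [u] contributes [Tu u] equal squared gaps. *)
  rewrite [leRHS](partition_big grp xpredT) //=; apply: ler_sum => u _.
  rewrite (eq_bigr (fun=> (4 * (nu u)%:R)^-1 ^+ 2)).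
    by rewrite sumr_const -Hcard cardsE [leLHS]mulr_natl.
  by move=> t /eqP <-; rewrite gapE.
- apply: measurable_sum => e; apply: measurable_funM => //.
  exact: (@measurable_regret R _ _ A (fin_space (outcome0 d T M)) d T.+1
    (fun e => sign_param R nn e.1) (@noise_at R d T M cd nn) _ L e mp).
- apply: measurable_sum => e; apply: measurable_funM => //.
  exact: (@measurable_num_queries R _ _ A (fin_space (outcome0 d T M)) d T.+1
    (fun e => sign_param R nn e.1) (@noise_at R d T M cd nn) _ L e mq).
- move=> a; apply: sumr_ge0 => e _; rewrite mulr_ge0 // sumr_ge0 // => t _.
  exact: sqr_ge0.
- by move=> a; apply: sumr_ge0 => e _; rewrite mulr_ge0.
- by rewrite mulr_ge0 // divr_ge0 // sqr_ge0.
- by apply: sumr_ge0 => t _; exact: sqr_ge0.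
Qed.
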